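(* Let $E=\mathbb C/(\mathbb Z+\tau\mathbb Z)$ with $t=\mathrm{Im}\,\tau>0$, let $m,n\in\mathbb N$ and $\xi=a\tau+b$ with $a,b\in\mathbb R$. Let $C=(\langle\Phi_i,\Phi_j\rangle)_{1\le i,j\le m}$ be the Gram matrix of the basis $(\Phi_1,\dots,\Phi_m)$ of the Haldane--Rezayi space $\mathsf V_{m,n,\xi}$. Then $C=c(\xi)I_m$ for some $c(\xi)\in\mathbb C$.
   Context: For $\alpha,\beta\in\mathbb R$, $\vartheta[\alpha,\beta](z|\tau)=\sum_{k\in\mathbb Z}\exp(\pi i\tau(k+\alpha)^2+2\pi i(k+\alpha)(z+\beta))$ and $\vartheta(z)=\vartheta[\frac12,\frac12](z|\tau)$. For $1\le j\le m$, $$\Phi_j(z_1,\dots,z_n)=\vartheta\Bigl[\frac{j-1}m,0\Bigr](mw+\xi\,|\,m\tau)\Bigl(\prod_{1\le p<q\le n}\vartheta(z_p-z_q)\Bigr)^m,\qquad w=z_1+\dots+z_n,$$ and $\mathsf V_{m,n,\xi}=\langle\Phi_1,\dots,\Phi_m\rangle_{\mathbb C}$. The scalar product is that of the space of $L^2$ sections of a hermitian line bundle $\mathcal W_{m,n,\xi}$ on $X=E^n$ containing $\mathsf V_{m,n,\xi}$: writing $z_j=x_j+\tau y_j$ with $x_j,y_j\in\mathbb R$, $$\langle\Phi,\Psi\rangle=\int_{[0,1]^{2n}}\Phi\,\overline\Psi\,\prod_{j=1}^n\exp\bigl(-2\pi mn\,t\,y_j^2-4\pi a\,t\,y_j\bigr)\,dx_1dy_1\cdots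 dx_ndy_n.$$ (Elements of $\mathsf V_{m,n,\xi}$ satisfy, in each variable, $\Phi(z_j+1)=\epsilon\,\Phi$, $\Phi(z_j+\tau)=\epsilon\exp(-2\pi i\xi)\exp(-\pi i\tau-2\pi iz_j)^{mn}\Phi$ with $\epsilon=(-1)^{m(n-1)}$, so the integrand is doubly periodic.) *)

(* Defs.v *)
From HB Require Import structures.
From mathcomp Require Import all_boot all_order all_algebra.
From mathcomp Require Import complex.
From mathcomp Require Import all_classical all_reals all_analysis.
Set Implicit Arguments.
Unset Strict Implicit.
Unset Printing Implicit Defensive.
Import Order.TTheory GRing.Theory Num.Theory.
Import numFieldNormedType.Exports.
Local Open Scope classical_set_scope.
Local Open Scope ring_scope.

Section TupleMeasure.
Context d (T : measurableType d) (R : realType).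

Definition tcons n (p : n.-tuple T * T) : n.+1.-tuple T :=
  [the n.+1.-tuple T of p.2 :: p.1].

Lemma measurable_tcons n : measurable_fun [set: n.-tuple T * T] (@tcons n).
Proof. exact: measurable_cons. Qed.

Variable mu : {sigma_finite_measure set T -> \bar R}.

Section TensorCons.
Variables (n : nat) (m : {measure set (n.-tuple T) -> \bar R}).

Definition tensor_cons := pushforward (m \x mu)%E (@tcons n).

Let mcons : measurable_fun [set: n.-tuple T * T] (@tcons n).
Proof. exact: measurable_tcons. Qed.

Let tensor_cons0 : tensor_cons set0 = 0%E. Proof. exact: measure0. Qed.

Let tensor_cons_ge0 A : (0 <= tensor_cons A)%E. Proof. exact: measure_ge0. Qed.

Let tensor_cons_sigma_additive : semi_sigma_additive tensor_cons.
Proof. exact: measure_semi_sigma_additive. Qed.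

HB.instance Definition _ := isMeasure.Build _ _ _ tensor_cons
  tensor_cons0 tensor_cons_ge0 tensor_cons_sigma_additive.

End TensorCons.

Fixpoint tuple_measure (n : nat) : {measure set (n.-tuple T) -> \bar R} :=
  if n is k.+1 then tensor_cons (tuple_measure k) else dirac [tuple].

End TupleMeasure.

Section HaldaneRezayi.
Variable R : realType.
Local Notation C := R[i].
Local Open Scope complex_scope.

Definition cexp (z : C) : C :=
  (expR (complex.Re z))%:C * (cos (complex.Im z) +i* sin (complex.Im z)).

(* The sum over Z is split at 0; R[i]^o carries the topology of the norm. *)
Definition sum_int (f : int -> C) : C :=
  limn (series (fun k : nat => f (Posz k) : C^o)) +
  limn (series (fun k : nat => f (Negz k) : C^o)).

Definition theta_char (al be : R) (z tau : C) : C :=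
  sum_int (fun k : int =>
    cexp (pi%:C * 'i * tau * (k%:~R + al%:C) ^+ 2
          + 2 * pi%:C * 'i * (k%:~R + al%:C) * (z + be%:C))).

Definition vartheta (tau z : C) : C := theta_char 2^-1 2^-1 z tau.

(* j : 'I_m counts from 0, so j%:R / m%:R is the characteristic (j - 1) / m of
   the basis indexed by 1, ..., m. *)
Definition HR_Phi (m n : nat) (tau xi : C) (j : 'I_m) (z : 'I_n -> C) : C :=
  theta_char (j%:R / m%:R) 0 (m%:R * (\sum_p z p) + xi) (m%:R * tau)
  * (\prod_(p < n) \prod_(q < n | (p < q)%N) vartheta tau (z p - z q)) ^+ m.

Definition cRintegral d (T : measurableType d)
    (mu : {measure set T -> \bar R}) (D : set T) (f : T -> C) : C :=
  (\int[mu]_(u in D) complex.Re (f u)) +i* (\int[mu]_(u in D) complex.Im (f u)).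

(* [0,1]^(2n) carries the 2n-dimensional Lebesgue measure; its first n
   coordinates are the x_j, its last n coordinates are the y_j. *)
Definition HR_dot (m n : nat) (tau : C) (a : R) (F G : ('I_n -> C) -> C) : C :=
  cRintegral (tuple_measure (@lebesgue_measure R) (n + n))
    [set u | forall k, 0 <= tnth u k <= 1]
    (fun u =>
      let x j : R := tnth u (lshift n j) in
      let y j : R := tnth u (rshift n j) in
      let t := complex.Im tau in
      let z j := (x j)%:C + tau * (y j)%:C in
      F z * (G z)^* *
      (\prod_(j < n) expR (- (2 * pi * m%:R * n%:R * t * y j ^+ 2)
                           - 4 * pi * a * t * y j))%:C).

Definition gram_mx (m : nat) (V : Type) (dot : V -> V -> C) (b : 'I_m -> V) :
    'M[C]_m :=
  \matrix_(i, j) dot (b i) (b j).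

End HaldaneRezayi.

(* Main.v *)
(** The Gaussian weight can be split with
    n * sum_p y_p^2 = (sum_p y_p)^2 + sum_(p < q) (y_p - y_q)^2,
    so that every theta function in the integrand of <Phi_i, Phi_j> absorbs its
    own factor exp(- pi (Im z)^2 / Im tau).  A product of two such normalised
    theta functions, one conjugated, is truly periodic: the quasi-periodicity
    factors have become phases that cancel.  The integrand is therefore
    1-periodic in each of the 2n real coordinates, and its integral over the
    unit cube is unchanged by translations.  Moving all the x_p by 1/(mn)
    multiplies the integrand by exp(2 pi i (i - j) / m), so that
    <Phi_i, Phi_j> = 0 when i <> j; moving all the y_p by 1/(mn) adds 1/m to both
    characteristics, so that the norms of the Phi_i are all equal. *)

From HB Require Import structures.
Require Import Defs.
From mathcomp Require Import all_boot all_order all_algebra.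
From mathcomp Require Import complex.
From mathcomp Require Import all_classical all_reals all_analysis.
From mathcomp Require Import measurable_realfun ring lra.
Set Implicit Arguments.
Unset Strict Implicit.
Unset Printing Implicit Defensive.
Import Order.TTheory GRing.Theory Num.Theory.
Import numFieldNormedType.Exports.
Local Open Scope classical_set_scope.
Local Open Scope ring_scope.

(** * Measure and integration on the cube *)

Section Box.
Context d (T : measurableType d) (R : realType).
Variable mu : {sigma_finite_measure set T -> \bar R}.

Definition box (I : set T) {n} : set (n.-tuple T) :=
  [set u | forall k, I (tnth u k)].

Lemma box_tcons (I : set T) n (u : n.-tuple T) x :
  box I (tcons (u, x)) <-> box I u /\ I x.
Proof.
split=> [H|[Hu Ix] k].
  split; last by have := H ord0; rewrite tnth0.
  by move=> k; have := H (lift ord0 k); rewrite tnthS.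
by case: (unliftP ord0 k) => [j ->|->]; rewrite ?tnthS ?tnth0.
Qed.

Lemma measurable_box I n : measurable I -> measurable (@box (I : set T) n).
Proof.
move=> mI.
have -> : box I = \bigcap_(k in [set: 'I_n]) ((fun u : n.-tuple T => tnth u k) @^-1` I).
  by apply/seteqP; split=> [u H k _|u H k]; exact: H.
apply: fin_bigcap_measurable => // k _.
by rewrite -[X in measurable X]setTI; exact: measurable_tnth.
Qed.

Lemma tuple_measureS n : tuple_measure mu n.+1 =
  pushforward (tuple_measure mu n \x mu)%E (@tcons _ T n) :> (set _ -> \bar R).
Proof. by []. Qed.

Lemma tuple_measure_box (I : set T) n : measurable I -> (mu I < +oo)%E ->
  (tuple_measure mu n (box I) < +oo)%E.
Proof.
move=> mI Ifin; elim: n => [|n IHn].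
  by rewrite /= /dirac/= indicE; case: (_ \in _); rewrite ltry.
rewrite tuple_measureS /pushforward.
have -> : tcons (n := n) @^-1` box I = box I `*` I.
  by apply/seteqP; split=> -[u x] /box_tcons.
rewrite product_measure1E//; last exact: measurable_box.
by apply: lte_mul_pinfty => //; rewrite ge0_fin_numE.
Qed.

(** Boxes over an increasing sequence of sets of finite measure have finite measure and exhaust the
    power; this opens [tuple_measure] to Tonelli. *)
Lemma sigma_finite_tuple_measure n : sigma_finite setT (tuple_measure mu n).
Proof.
have /sigma_finiteP[F [TF ndF Ffin]] := sigma_finiteT mu.
exists (fun k => box (F k)) => [|k]; last first.
  have [mF muF] := Ffin k.
  by split; [exact: measurable_box|exact: tuple_measure_box].
apply/seteqP; split=> // u _.
have: forall k, exists i, F i (tnth u k).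
  move=> k; have : [set: T] (tnth u k) by [].
  by rewrite TF => -[i _ Fi]; exists i.
(* Each coordinate enters [F] at its own index; as [F] is increasing, the largest of these finitely
   many indices serves all coordinates. *)
move=> /choice[f Hf]; exists (\max_(k < n) f k)%N => // k.
have /subsetPset := ndF _ _ (leq_bigmax (F := f) k); apply; exact: Hf.
Qed.

(** [tuple_measure] is built as the image of a product measure under [tcons], so this is a change of
    variables followed by Tonelli, with nonnegativity in place of integrability. *)
Lemma integral_boxS (I : set T) n (f : n.+1.-tuple T -> \bar R) : measurable I ->
  measurable_fun [set: n.+1.-tuple T] f -> (forall u, 0 <= f u)%E ->
  (\int[tuple_measure mu n.+1]_(u in box I) f u =
   \int[tuple_measure mu n]_(u in box I) \int[mu]_(x in I) f (tcons (u, x)))%E.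
Proof.
move=> mI mf f0.
have sf := sigma_finite_tuple_measure n.
(* [tuple_measure] is typed as a mere measure while Tonelli asks for a sigma-finite one, so the same
   measure is repackaged as [m1]. *)
pose H2 := isSFinite.Build _ _ _ _ (sfinite_measure_sigma_finite sf).
pose H3 := isSigmaFinite.Build _ _ _ _ sf.
pose m1 := HB.pack_for {sigma_finite_measure set (n.-tuple T) -> \bar R}
  (Measure.sort (tuple_measure mu n)) H2 H3.
have mfI : measurable_fun [set: n.+1.-tuple T] (f \_ (box I)).
  apply/(measurable_restrictT _ _).1; [exact: measurable_box|exact: measurable_funTS].
have fI0 u : (0 <= (f \_ (box I)) u)%E by rewrite /patch; case: ifP.
rewrite integral_mkcond tuple_measureS ge0_integral_pushforward//; last exact: measurable_tcons.
rewrite preimage_setT.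
have -> : (tuple_measure mu n : set _ -> _) = m1 by [].
rewrite [LHS](fubini_tonelli1 (m1 := m1)); last first.
- by move=> p; exact: fI0.
- by apply: (measurableT_comp mfI); exact: measurable_tcons.
rewrite [RHS]integral_mkcond; apply: eq_integral => u _ /=.
rewrite /fubini_F/= [RHS]/patch.
case: ifPn => [/set_mem|/negP] Hu.
  rewrite [RHS]integral_mkcond; apply: eq_integral => x _; rewrite /patch.
  congr (if _ then _ else _); apply/idP/idP => /set_mem H; apply/mem_set.
    by have /box_tcons[] := H.
  by apply/box_tcons.
apply: integral0_eq => x _; rewrite /patch; case: ifP => // /set_mem/box_tcons[H _].
by case: Hu; exact/mem_set.
Qed.

End Box.

(** * Translation of Lebesgue integrals on the real line *)

Section Shift.
Context (R : realType).
Local Notation mu := (@lebesgue_measure R).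
Local Notation TR := (measurableTypeR R).

Lemma measurable_shift (s : R) :
  measurable_fun [set: TR] (fun x : TR => (x + s)%R : TR).
Proof. by apply: measurable_funD => //; exact: measurable_id. Qed.

(** Lebesgue measure is determined by its values on half-open intervals, and a translation preserves
    their lengths. *)
Lemma lebesgue_measure_shift (s : R) (A : set TR) : measurable A ->
  pushforward mu (fun x : TR => (x + s)%R : TR) A = mu A.
Proof.
move=> mA; apply/esym.
pose H := @measurable_shift s.
apply: (lebesgue_measure_unique
  (mu := [the measure _ _ of pushforward mu (fun x : TR => (x + s)%R : TR)]))
  => //= _ [[a b]] _ <-.
rewrite /pushforward.
have -> : (fun x : R => x + s) @^-1` `]a, b] = `]a - s, b - s]%classic.
  by apply/seteqP; split=> x /=; rewrite !in_itv/=; lra.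
rewrite !lebesgue_measure_itv/= !lte_fin.
by rewrite ltrD2r -!EFinD; congr (if _ then _ else _); congr EFin; ring.
Qed.

Lemma ge0_integral_shift (s : R) (D : set TR) (f : TR -> \bar R) :
  measurable D -> measurable_fun setT f -> (forall x, 0 <= f x)%E ->
  (\int[mu]_(x in D) f x =
   \int[mu]_(x in (fun x => x + s)%R @^-1` D) f (x + s)%R)%E.
Proof.
move=> mD mf f0.
have -> : (\int[mu]_(x in D) f x =
  \int[pushforward mu (fun x : TR => (x + s)%R : TR)]_(x in D) f x)%E.
  apply: eq_measure_integral; first exact: measurable_shift.
  by move=> ms A mA _; exact/esym/lebesgue_measure_shift.
rewrite ge0_integral_pushforward//; first exact: measurable_shift.
exact: measurable_funTS.
Qed.

(** The window [[s, 1 + s[] is cut at [1], and the part beyond [1] is brought back to [[0, s[] by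
    one period. *)
Lemma integral_periodic_shift (s : R) (f : TR -> \bar R) :
  measurable_fun setT f -> (forall x, 0 <= f x)%E ->
  (forall x : R, f (x + 1)%R = f x) -> (0 <= s <= 1)%R ->
  (\int[mu]_(x in [set x : R | 0 <= x <= 1]%R) f (x + s)%R =
   \int[mu]_(x in [set x : R | 0 <= x <= 1]%R) f x)%E.
Proof.
move=> mf f0 f1 s01.
have -> : [set x : R | 0 <= x <= 1] = `[0, 1]%classic.
  by apply/seteqP; split=> x /=; rewrite in_itv.
have mfs : measurable_fun [set: TR] (fun x : TR => f (x + s)%R).
  by apply: (measurableT_comp mf); exact: measurable_shift.
(* Dropping the null endpoint [1] lets the intervals be cut into disjoint pieces. *)
rewrite -!integral_itv_bndo_bndc; [|exact: measurable_funTS..].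
have -> : `[0, 1[%classic = (fun x => x + s) @^-1` `[s, 1 + s[ :> set R.
  by apply/seteqP; split=> x /=; rewrite !in_itv/=; lra.
rewrite -ge0_integral_shift//.
(* The domain on the right was rewritten into the same preimage; it is [[0, 1[] again, now cut at
   [s]. *)
have -> : ((fun x => x + s) @^-1` `[s, 1 + s[ = `[0, s[ `|` `[s, 1[ :> set R)%classic.
  by apply/seteqP; split=> x /=; rewrite !in_itv/=;
    [case: (ltP x s); [left|right]; lra|case; lra].
have -> : (`[s, 1 + s[ = `[s, 1[ `|` `[1, 1 + s[ :> set R)%classic.
  by apply/seteqP; split=> x /=; rewrite !in_itv/=;
    [case: (ltP x 1); [left|right]; lra|case; lra].
rewrite !ge0_integral_setU//=; try exact: measurable_funTS.
- rewrite addeC; congr (_ + _)%E.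
  rewrite (ge0_integral_shift 1)//.
  have -> : (fun x => x + 1) @^-1` `[1, 1 + s[ = `[0, s[%classic :> set R.
    by apply/seteqP; split=> x /=; rewrite !in_itv/=; lra.
  by apply: eq_integral => x _; rewrite f1.
- by apply/disj_setPS => x /=; rewrite !in_itv/=; lra.
- by apply/disj_setPS => x /=; rewrite !in_itv/=; lra.
Qed.

End Shift.

(** * Translation of periodic integrands on the unit cube *)

Section CubeShift.
Context (R : realType).
Local Notation TR := (measurableTypeR R).
Local Notation mun := (tuple_measure (@lebesgue_measure R)).
Local Notation cube := (box [set x : TR | 0 <= x <= 1]).

Definition tshift n (v : 'I_n -> R) (u : n.-tuple TR) : n.-tuple TR :=
  [tuple tnth u j + v j | j < n].

Lemma tshift_tcons n (v : 'I_n.+1 -> R) (u : n.-tuple TR) (x : TR) :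
  tshift v (tcons (u, x)) = tcons (tshift (v \o lift ord0) u, x + v ord0).
Proof.
apply: eq_from_tnth => k; rewrite tnth_mktuple.
by case: (unliftP ord0 k) => [j ->|->]; rewrite ?tnthS ?tnth0 ?tnth_mktuple.
Qed.

Lemma measurable_tshift n (v : 'I_n -> R) :
  measurable_fun [set: n.-tuple TR] (tshift v).
Proof.
apply/measurable_fun_tnthP => k /=.
rewrite [X in measurable_fun _ X](_ : _ =
    (fun x : TR => x + v k : TR) \o (@tnth n TR ^~ k)).
  by apply: measurableT_comp; [exact: measurable_shift|exact: measurable_tnth].
by apply/funext => u /=; rewrite tnth_mktuple.
Qed.

Definition tperiodic n U (f : n.-tuple TR -> U) :=
  forall k u, f (tshift (fun j => (j == k)%:R) u) = f u.

Lemma measurable_unit_itv : measurable [set x : TR | 0 <= x <= 1].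
Proof.
have -> : [set x : TR | 0 <= x <= 1] = `[0, 1]%classic.
  by apply/seteqP; split=> x /=; rewrite in_itv.
exact: measurable_itv.
Qed.

(** Induction on the dimension: the head coordinate is handled by the one-variable lemma inside the
    inner integral, the others by the induction hypothesis applied to the partial integral [g],
    which inherits measurability, positivity and periodicity. *)
Lemma ge0_integral_cube_shift n (v : 'I_n -> R) (f : n.-tuple TR -> \bar R) :
  (forall k, 0 <= v k <= 1) ->
  measurable_fun [set: n.-tuple TR] f -> (forall u, 0 <= f u)%E -> tperiodic f ->
  (\int[mun n]_(u in cube) f (tshift v u) = \int[mun n]_(u in cube) f u)%E.
Proof.
elim: n v f => [|n IHn] v f v01 mf f0 fper.
  by apply: eq_integral => u _; congr f; rewrite (tuple0 u) tuple0.
have mI := measurable_unit_itv.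
have mfs : measurable_fun [set: n.+1.-tuple TR] (f \o tshift v).
  by apply: measurableT_comp => //; exact: measurable_tshift.
rewrite [LHS](integral_boxS _ mI mfs); last by move=> u; exact: f0.
rewrite [RHS](integral_boxS _ mI mf f0).
pose g (u : n.-tuple TR) :=
  (\int[lebesgue_measure]_(x in [set x : TR | 0 <= x <= 1]%R) f (tcons (u, x)))%E.
have mtc (u : n.-tuple TR) : measurable_fun [set: TR] (fun x : TR => f (tcons (u, x))).
  exact: (measurableT_comp mf
    (measurableT_comp (@measurable_tcons _ TR n) (pair1_measurable u))).
transitivity (\int[mun n]_(u in cube) g (tshift (v \o lift ord0) u))%E.
  apply: eq_integral => u _; rewrite /g.
  rewrite -[RHS](integral_periodic_shift (s := v ord0))//.
    by apply: eq_integral => x _ /=; rewrite tshift_tcons.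
  move=> x; rewrite -[RHS](fper ord0) tshift_tcons eqxx.
  congr f; congr (tcons (_, _)); apply: eq_from_tnth => k.
  by rewrite [RHS]tnth_mktuple; exact/esym/addr0.
rewrite IHn// => [k||u|k u].
- exact: v01.
(* Once the integrand is cut off outside the slab, [g] is a section integral over the whole line,
   and the measurability part of Tonelli applies. *)
- pose h := ((f \o @tcons _ TR n) \_ (setT `*` [set x : TR | 0 <= x <= 1]))%classic.
  have -> : g = fubini_F lebesgue_measure h.
    apply/funext => u; rewrite /g /fubini_F [LHS]integral_mkcond; apply: eq_integral => x _.
    rewrite /h /patch; congr (if _ then _ else _).
    by apply/idP/idP => /set_mem H; apply/mem_set => //; case: H.
  have h0 p : (0 <= h p)%E by rewrite /h /patch; case: (p \in _) => //=; exact: f0.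
  apply: measurable_fun_fubini_tonelli_F; last exact: h0.
  apply/(measurable_restrictT _ _).1; first exact: measurableX.
  apply: measurable_funTS; apply: measurableT_comp => //; exact: measurable_tcons.
- by apply: integral_ge0.
- apply: eq_integral => x _; rewrite -[RHS](fper (lift ord0 k)) tshift_tcons.
  congr f; congr (tcons (_, _)); last by rewrite (negbTE (neq_lift _ _)) addr0.
Qed.

(** The positive and negative parts of [f] are nonnegative and periodic, so each is covered by the
    previous lemma without any integrability. *)
Lemma Rintegral_cube_shift n (v : 'I_n -> R) (f : n.-tuple TR -> R) :
  (forall k, 0 <= v k <= 1) ->
  measurable_fun [set: n.-tuple TR] f -> tperiodic f ->
  (\int[mun n]_(u in cube) f (tshift v u) = \int[mun n]_(u in cube) f u)%R.
Proof.
move=> v01 mf fper; rewrite /Rintegral; congr fine.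
have mE : measurable_fun [set: n.-tuple TR] (EFin \o f) by exact/measurable_EFinP.
rewrite integralE [RHS]integralE; congr (_ - _)%E.
- have := @ge0_integral_cube_shift n v ((EFin \o f)^\+)%E v01 (measurable_funepos mE)
    (funepos_ge0 _).
  by rewrite funepos.unlock; apply => k u /=; rewrite fper.
- have := @ge0_integral_cube_shift n v ((EFin \o f)^\-)%E v01 (measurable_funeneg mE)
    (funeneg_ge0 _).
  by rewrite funeneg.unlock; apply => k u /=; rewrite fper.
Qed.

Lemma integrable_cube n (f : n.-tuple TR -> R) (K : R) :
  measurable_fun [set: n.-tuple TR] f -> (forall u, cube u -> `|f u| <= K) ->
  (mun n).-integrable cube (EFin \o f).
Proof.
move=> mf fK; have mC := @measurable_box _ _ _ n measurable_unit_itv.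
apply: measurable_bounded_integrable => //.
- apply: tuple_measure_box; first exact: measurable_unit_itv.
  have -> : [set x : TR | 0 <= x <= 1] = `[0, 1]%classic.
    by apply/seteqP; split=> x /=; rewrite in_itv.
  change (@lebesgue_measure R `[0%R, 1%R]%classic < +oo)%E.
  by rewrite lebesgue_measure_itv /= lte_fin ltr01 ltry.
- exact: measurable_funTS.
- exists K; split; first exact: num_real.
  by move=> M KM u /= Cu; apply: le_trans (ltW KM); exact: fK.
Qed.

End CubeShift.

(** * Theta series *)

Section ComplexSeries.
Variable R : realType.
Local Notation C := R[i].
Local Notation Re := (@complex.Re R).
Local Notation Im := (@complex.Im R).
Local Open Scope complex_scope.

Lemma ReM (z w : C) : Re (z * w) = Re z * Re w - Im z * Im w.
Proof. by case: z w => [a b] [c d]. Qed.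

Lemma ImM (z w : C) : Im (z * w) = Re z * Im w + Im z * Re w.
Proof. by case: z w => [a b] [c d]. Qed.

Lemma ReD (z w : C) : Re (z + w) = Re z + Re w.
Proof. by case: z w => [a b] [c d]. Qed.

Lemma ImD (z w : C) : Im (z + w) = Im z + Im w.
Proof. by case: z w => [a b] [c d]. Qed.

Lemma ImB (z w : C) : Im (z - w) = Im z - Im w.
Proof. by case: z w => [u v] [c d]. Qed.

Lemma conjcM (z w : C) : ((z * w)^* = (z^*)%C * (w^*)%C)%C.
Proof. exact: rmorphM. Qed.

(* As a factor of a product, [z^*] is parsed as [Num.conj z]. *)
Lemma conjCE (z : C) : Num.conj z = (z^*)%C.
Proof. by []. Qed.

Lemma complex_eq (z w : C) : Re z = Re w -> Im z = Im w -> z = w.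
Proof. by case: z w => [a b] [c d] /= -> ->. Qed.

Lemma normc_leD (z : C) : `|z| <= (`|Re z| + `|Im z|)%:C.
Proof.
rewrite [in X in X <= _](complexE z) (le_trans (ler_normD _ _))//.
rewrite rmorphD lerD//.
- by rewrite normc_def/= expr0n addr0 sqrtr_sqr.
- by rewrite normrM !normc_def/= !expr0n/= add0r addr0 expr1n sqrtr1 sqrtr_sqr mul1r.
Qed.

Lemma cvg_complex (u : nat -> C) (l : C) :
  (Re \o u) @ \oo --> Re l -> (Im \o u) @ \oo --> Im l ->
  (u : nat -> C^o) @ \oo --> (l : C^o).
Proof.
move=> ur ui; apply/cvgrPdist_lt => /= e e0.
(* The radius ranges over [R[i]]; being positive, it is real. *)
have [e1 eE] : exists e1, e = e1%:C by exists (Re e); rewrite RRe_real// gtr0_real.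
move: e0; rewrite eE ltcR => e0.
have e20 : 0 < e1 / 2 by rewrite divr_gt0.
move/cvgrPdist_lt : ur => /(_ _ e20) ur; move/cvgrPdist_lt : ui => /(_ _ e20) ui.
near=> n.
apply: le_lt_trans (normc_leD _) _; rewrite ltcR [ltRHS](splitr e1) ltrD//.
- by rewrite raddfB/=; near: n.
- by rewrite raddfB/=; near: n.
Unshelve. all: by end_near. Qed.

Lemma geometric_dominated_series (a : nat -> R) (K q : R) : 0 <= q < 1 ->
  (forall n, `|a n| <= K * q ^+ n) ->
  cvgn (series a) /\ `|limn (series a)| <= K / (1 - q).
Proof.
move=> /andP[q0 q1] aK.
have Nq : `|q| < 1 by rewrite ger0_norm.
have gcv := is_cvg_geometric_series (a := K) Nq.
have ncv : cvgn [normed series a].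
  by apply: series_le_cvg gcv => n //=; exact: le_trans (aK n).
split; first exact: normed_cvg.
apply: le_trans (lim_series_norm ncv) _.
rewrite -(cvg_lim (@Rhausdorff R) (cvg_geometric_series (a := K) Nq)).
exact: lim_series_le.
Qed.

Definition geometric_dominated (K q : R) (f : nat -> C) :=
  forall n, `|Re (f n)| <= K * q ^+ n /\ `|Im (f n)| <= K * q ^+ n.

Lemma Re_series (f : nat -> C) : Re \o series (f : nat -> C^o) = series (Re \o f).
Proof. by apply/funext => n; rewrite /series /= raddf_sum. Qed.

Lemma Im_series (f : nat -> C) : Im \o series (f : nat -> C^o) = series (Im \o f).
Proof. by apply/funext => n; rewrite /series /= raddf_sum. Qed.

(** The three conclusions have separate uses: convergence for manipulating theta series,
    componentwise limits for measurability, and the explicit bound for boundedness on horizontal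
    strips. *)
Lemma complex_seriesP (K q : R) (f : nat -> C) : 0 <= q < 1 ->
    geometric_dominated K q f ->
  let l : C := limn (series (f : nat -> C^o)) in
  [/\ cvgn (series (f : nat -> C^o)),
      series (Re \o f) @ \oo --> Re l /\ series (Im \o f) @ \oo --> Im l &
      `|Re l| <= K / (1 - q) /\ `|Im l| <= K / (1 - q)].
Proof.
move=> q01 fK.
have [crf bre] := geometric_dominated_series q01 (fun n => (fK n).1).
have [cif bim] := geometric_dominated_series q01 (fun n => (fK n).2).
have cf : (series (f : nat -> C^o)) @ \oo -->
    ((limn (series (Re \o f)) +i* limn (series (Im \o f))) : C^o).
  apply: cvg_complex => /=.
  - by rewrite Re_series.
  - by rewrite Im_series.
have -> : limn (series (f : nat -> C^o)) =
    limn (series (Re \o f)) +i* limn (series (Im \o f)).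
  exact: (cvg_lim (@norm_hausdorff _ _) cf).
by split=> //=; apply: cvgP cf.
Qed.

(** [limn] takes a default value on a divergent series, so linearity and reindexing of [sum_int] are
    stated under convergence of both halves. *)
Definition cvg_sum_int (f : int -> C) :=
  cvgn (series (fun k : nat => f (Posz k) : C^o)) /\
  cvgn (series (fun k : nat => f (Negz k) : C^o)).

Lemma eq_sum_int (f g : int -> C) : f =1 g -> sum_int f = sum_int g.
Proof. by move=> /funext ->. Qed.

Lemma sum_intZ (c : C) (f : int -> C) : cvg_sum_int f ->
  sum_int (fun k => c * f k) = c * sum_int f.
Proof.
move=> [cp cn]; rewrite /sum_int mulrDr.
have := lim_seriesZ c cp; have := lim_seriesZ c cn.
by rewrite /GRing.scale/= => <- <-.
Qed.

Lemma series_recl (f : nat -> C) : cvgn (series (f : nat -> C^o)) ->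
  cvgn (series (fun n => f n.+1 : C^o)) /\
  limn (series (f : nat -> C^o)) = f 0%N + limn (series (fun n => f n.+1 : C^o)) :> C.
Proof.
move=> cf.
have sE n : series (fun n => f n.+1 : C^o) n = series (f : nat -> C^o) n.+1 - f 0%N.
  by rewrite /series/= big_nat_recl// addrC addKr.
have cS : series (fun n => f n.+1 : C^o) @ \oo -->
    (limn (series (f : nat -> C^o)) - (f 0%N : C^o)).
  rewrite (funext sE).
  apply: cvgB; last exact: cvg_cst.
  by rewrite (cvg_shiftS (series (f : nat -> C^o))).
split; first exact: cvgP cS.
by rewrite (cvg_lim (@norm_hausdorff _ _) cS) addrC subrK.
Qed.

(** The sum is split at 0, so the shift carries the single term [f 0] from the nonnegative half to
    the negative one. *)
Lemma sum_int_shift (f : int -> C) : cvg_sum_int f ->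
  sum_int (fun k => f (k + 1)) = sum_int f.
Proof.
move=> [cp cn]; rewrite /sum_int.
have [_ ->] := series_recl cp.
have -> : (fun k : nat => f (Posz k + 1)) = (fun k : nat => f (Posz k.+1)).
  by apply/funext => k; rewrite -addn1 PoszD.
(* Since [Negz 0] is -1, [g 0] is the migrating term [f 0], and the tail of [g] is the old negative
   half. *)
pose g (k : nat) := f (Negz k + 1).
have gS : (fun k : nat => g k.+1) = (fun k : nat => f (Negz k)).
  by apply/funext => k; rewrite /g; congr f; rewrite !NegzE (intS k.+1); ring.
have gcv : cvgn (series (g : nat -> C^o)).
  have : cvgn (series (fun k : nat => g k.+1 : C^o)) by rewrite gS.
  move=> c1.
  have sE n : series (g : nat -> C^o) n.+1 =
      (g 0%N : C^o) + series (fun n => g n.+1 : C^o) n.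
    by rewrite /series/= big_nat_recl.
  have cS : (fun n => series (g : nat -> C^o) n.+1) @ \oo -->
      ((g 0%N : C^o) + limn (series (fun k : nat => g k.+1 : C^o))).
    by rewrite (funext sE); apply: cvgD; [exact: cvg_cst|exact: c1].
  by move: cS; rewrite (cvg_shiftS (series (g : nat -> C^o))); exact: cvgP.
have [_ ->] := series_recl gcv.
rewrite gS addrA; congr (_ + _); rewrite addrC; congr (_ + _).
Qed.

End ComplexSeries.

(** * Convergence and transformation laws of theta functions with characteristics *)

Section Theta.
Variable R : realType.
Local Notation C := R[i].
Local Notation Re := (@complex.Re R).
Local Notation Im := (@complex.Im R).
Local Open Scope complex_scope.

Lemma Re_cexp (z : C) : Re (cexp z) = expR (Re z) * cos (Im z).
Proof. by rewrite /cexp ReM /= mul0r subr0. Qed.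

Lemma Im_cexp (z : C) : Im (cexp z) = expR (Re z) * sin (Im z).
Proof. by rewrite /cexp ImM /= mul0r addr0. Qed.

Lemma cexpD (z w : C) : cexp (z + w) = cexp z * cexp w.
Proof.
apply: complex_eq.
- by rewrite Re_cexp ReM !Re_cexp !Im_cexp !raddfD/= expRD cosD; ring.
- by rewrite Im_cexp ImM !Re_cexp !Im_cexp !raddfD/= expRD sinD; ring.
Qed.

Lemma cexp0 : cexp (0 : C) = 1.
Proof. by rewrite /cexp/= expR0 cos0 sin0 mul1r. Qed.

Lemma cexp_real (x : R) : cexp x%:C = (expR x)%:C.
Proof. by rewrite /cexp/= cos0 sin0 mulr1. Qed.

Lemma cexp_conj (z : C) : (cexp z)^* = cexp z^*.
Proof. by case: z => x y; apply: complex_eq; rewrite /cexp/= cosN sinN; ring. Qed.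

Lemma cexp_2pi_int (k : int) : cexp (2 * pi%:C * 'i * k%:~R) = 1 :> C.
Proof.
have E1 : cexp (2 * pi%:C * 'i) = 1 :> C.
  have -> : 2 * pi%:C * 'i = 0 +i* (pi *+ 2) :> C.
    by rewrite -(rmorph_nat (real_complex R) 2); apply: complex_eq; rewrite /=; ring.
  by rewrite /cexp/= expR0 cos2pi sin2pi mul1r.
have En (n : nat) : cexp (2 * pi%:C * 'i * n%:R) = 1 :> C.
  elim: n => [|n IHn]; rewrite ?mulr0 ?cexp0//.
  by rewrite -[n.+1%:R]natr1 mulrDr mulr1 cexpD IHn E1 mul1r.
case: k => n; first exact: En.
rewrite NegzE mulrNz mulrN -[LHS]mul1r -[X in X * _](En n.+1) -cexpD subrr.
exact: cexp0.
Qed.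

Definition theta_term (al be : R) (z tau : C) (k : int) : C :=
  cexp (pi%:C * 'i * tau * (k%:~R + al%:C) ^+ 2
        + 2 * pi%:C * 'i * (k%:~R + al%:C) * (z + be%:C)).

(** This real part controls the modulus of a theta term. It sees [z] and [tau] only through their
    imaginary parts, hence bounds uniform on horizontal strips. *)
Lemma Re_theta_exponent (al be : R) (z tau : C) (k : int) :
  Re (pi%:C * 'i * tau * (k%:~R + al%:C) ^+ 2
        + 2 * pi%:C * 'i * (k%:~R + al%:C) * (z + be%:C)) =
  - (pi * Im tau * (k%:~R + al) ^+ 2) - 2 * pi * (k%:~R + al) * Im z.
Proof.
case: tau z => [t1 t] [x y].
rewrite -(rmorph_int (real_complex R)) -(rmorph_nat (real_complex R) 2) -rmorphD.
by rewrite expr2/=; ring.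
Qed.

(* Completing the square and (k + s)^2 >= k^2/2 - s^2 leave a Gaussian in k alone. *)
Lemma theta_exponent_le (t y M al κ : R) (n : nat) : 0 < t -> `|y| <= M ->
  n%:R <= κ ^+ 2 ->
  - (pi * t * (κ + al) ^+ 2) - 2 * pi * (κ + al) * y <=
  pi * M ^+ 2 / t + pi * t * (`|al| + M / t) ^+ 2 + n%:R * - (pi * t / 2).
Proof.
move=> t0 yM nk; have t1 : t != 0 by rewrite gt_eqF.
have p0 : 0 < pi :> R := pi_gt0 R.
have -> : - (pi * t * (κ + al) ^+ 2) - 2 * pi * (κ + al) * y =
  pi * y ^+ 2 / t + pi * t * (al + y / t) ^+ 2 + κ ^+ 2 * - (pi * t / 2)
   - pi * t / 2 * (κ + 2 * (al + y / t)) ^+ 2 by field.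
have pt0 : 0 <= pi * t / 2 by rewrite divr_ge0// mulr_ge0// ltW.
rewrite lerBlDr; apply: ler_wpDr; first by rewrite mulr_ge0// sqr_ge0.
have y2 : y ^+ 2 <= M ^+ 2.
  by rewrite -(real_normK (num_real y)) ler_sqr ?nnegrE// (le_trans _ yM).
rewrite lerD// ?lerD//.
- by rewrite ler_pM2r ?invr_gt0// ler_pM2l.
- rewrite ler_pM2l ?mulr_gt0// -(real_normK (num_real (al + _))).
  have H : `|al + y / t| <= `|al| + M / t.
    by rewrite (le_trans (ler_normD _ _))// lerD2l normrM normfV
      (gtr0_norm t0) ler_pM2r ?invr_gt0.
  by rewrite ler_sqr ?nnegrE// (le_trans _ H).
- by rewrite ler_wnM2r// oppr_le0.
Qed.

Definition theta_bound (t M al : R) :=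
  expR (pi * M ^+ 2 / t + pi * t * (`|al| + M / t) ^+ 2).

Definition theta_ratio (t : R) := expR (- (pi * t / 2)).

Lemma theta_ratio_lt1 (t : R) : 0 < t -> 0 <= theta_ratio t < 1.
Proof. by move=> t0; rewrite expR_ge0 expR_lt1 oppr_lt0 !divr_gt0 ?mulr_gt0 ?pi_gt0. Qed.

(** Replacing [k ^+ 2] by a smaller [n] weakens the Gaussian decay to a geometric one. Keeping [n]
    apart from [k] serves both halves of the sum, with [k = n] and [k = - (n + 1)]. *)
Lemma theta_term_dominated (al be M : R) (z tau : C) (k : int) (n : nat) :
  0 < Im tau -> `|Im z| <= M -> n%:R <= (k%:~R : R) ^+ 2 ->
  `|Re (theta_term al be z tau k)| <=
    theta_bound (Im tau) M al * theta_ratio (Im tau) ^+ n /\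
  `|Im (theta_term al be z tau k)| <=
    theta_bound (Im tau) M al * theta_ratio (Im tau) ^+ n.
Proof.
move=> t0 zM nk; rewrite Re_cexp Im_cexp Re_theta_exponent.
rewrite /theta_bound /theta_ratio -expRM_natl -expRD !normrM !(ger0_norm (expR_ge0 _)).
have := theta_exponent_le al t0 zM nk; rewrite -ler_expR => H.
split; apply: le_trans H; rewrite ler_piMr ?expR_ge0// ler_norml.
- by rewrite cos_geN1 cos_le1.
- by rewrite sin_geN1 sin_le1.
Qed.

Lemma theta_Posz_dominated (al be M : R) (z tau : C) : 0 < Im tau -> `|Im z| <= M ->
  geometric_dominated (theta_bound (Im tau) M al) (theta_ratio (Im tau))
    (fun n => theta_term al be z tau (Posz n)).
Proof.
move=> t0 zM n; apply: theta_term_dominated => //.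
have : (n <= n ^ 2)%N by case: n => // n; rewrite -mulnn leq_pmulr.
by rewrite -(ler_nat R) natrX.
Qed.

Lemma theta_Negz_dominated (al be M : R) (z tau : C) : 0 < Im tau -> `|Im z| <= M ->
  geometric_dominated (theta_bound (Im tau) M al) (theta_ratio (Im tau))
    (fun n => theta_term al be z tau (Negz n)).
Proof.
move=> t0 zM n; apply: theta_term_dominated => //.
have : (n <= n.+1 ^ 2)%N by rewrite -mulnn (leq_trans (leqnSn n))// leq_pmulr.
by rewrite NegzE mulrNz sqrrN -(ler_nat R) natrX.
Qed.

Section Convergence.
Variables (al be : R) (tau : C).
Hypothesis tau_gt0 : 0 < Im tau.

Lemma cvg_theta (z : C) : cvg_sum_int (theta_term al be z tau).
Proof.
have q01 := theta_ratio_lt1 tau_gt0.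
split.
- by have [] := complex_seriesP q01 (theta_Posz_dominated al be tau_gt0 (lexx `|Im z|)).
- by have [] := complex_seriesP q01 (theta_Negz_dominated al be tau_gt0 (lexx `|Im z|)).
Qed.

Lemma theta_char_bounded (M : R) : exists K, forall z : C, `|Im z| <= M ->
  `|Re (theta_char al be z tau)| <= K /\ `|Im (theta_char al be z tau)| <= K.
Proof.
have q01 := theta_ratio_lt1 tau_gt0.
exists (theta_bound (Im tau) M al / (1 - theta_ratio (Im tau)) +
        theta_bound (Im tau) M al / (1 - theta_ratio (Im tau))) => z zM.
have [_ _ [rp ip]] := complex_seriesP q01 (theta_Posz_dominated al be tau_gt0 zM).
have [_ _ [rn im]] := complex_seriesP q01 (theta_Negz_dominated al be tau_gt0 zM).
set p := limn _ in rp ip; set l := limn _ in rn im.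
have -> : theta_char al be z tau = p + l by [].
by rewrite ReD ImD; split; apply: le_trans (ler_normD _ _) _; apply: lerD.
Qed.

(** The term of index [k] gains the phase of [k + al], in which the integer [k] contributes a factor
    1. *)
Lemma theta_charD1 (z : C) :
  theta_char al be (z + 1) tau = cexp (2 * pi%:C * 'i * al%:C) * theta_char al be z tau.
Proof.
rewrite -[RHS](sum_intZ (cexp (2 * pi%:C * 'i * al%:C)) (cvg_theta z)).
apply: eq_sum_int => k.
transitivity (cexp (2 * pi%:C * 'i * k%:~R) *
    (cexp (2 * pi%:C * 'i * al%:C) * theta_term al be z tau k)).
  by rewrite -!cexpD; congr cexp; ring.
by rewrite cexp_2pi_int mul1r.
Qed.

Lemma theta_char_shift (z : C) : theta_char (al + 1) be z tau = theta_char al be z tau.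
Proof.
rewrite -[RHS](sum_int_shift (cvg_theta z)); apply: eq_sum_int => k.
by rewrite /theta_term rmorphD intrD/=; congr cexp; ring.
Qed.

End Convergence.

(** Completing the square in each exponent turns a translation by [s * tau] into a change of
    characteristic. A real [s] is allowed because both the full period [s = 1] and the fraction
    [s = 1/m] are needed. *)
Lemma theta_charDtau (al be s : R) (z tau : C) : 0 < Im tau ->
  theta_char al be (z + s%:C * tau) tau =
  cexp (- (pi%:C * 'i * s%:C ^+ 2 * tau) - 2 * pi%:C * 'i * s%:C * (z + be%:C)) *
  theta_char (al + s) be z tau.
Proof.
move=> t0; rewrite -[RHS](sum_intZ _ (cvg_theta (al + s) be t0 z)).
apply: eq_sum_int => k; rewrite -cexpD; congr cexp.
by rewrite rmorphD/=; ring.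
Qed.

End Theta.

(** * Measurability and boundedness of complex functions *)

Section ComplexMeasurable.
Context d (T : measurableType d) (R : realType).
Local Notation C := R[i].
Local Notation Re := (@complex.Re R).
Local Notation Im := (@complex.Im R).
Local Open Scope complex_scope.
Implicit Types f g : T -> C.

(** Measurability is componentwise, to match [cRintegral], which integrates real and imaginary parts
    separately. *)
Definition cmeasurable f :=
  measurable_fun [set: T] (fun u => Re (f u)) /\
  measurable_fun [set: T] (fun u => Im (f u)).

Lemma cmeasurable_cst (c : C) : cmeasurable (fun=> c).
Proof. by split; exact: measurable_cst. Qed.

Lemma cmeasurable_real (h : T -> R) : measurable_fun [set: T] h ->
  cmeasurable (fun u => (h u)%:C).
Proof. by move=> mh; split => //=; exact: measurable_cst. Qed.

Lemma cmeasurableD f g : cmeasurable f -> cmeasurable g ->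
  cmeasurable (fun u => f u + g u).
Proof.
move=> [fr fi] [gr gi]; split.
- by under eq_fun do rewrite ReD; exact: measurable_funD.
- by under eq_fun do rewrite ImD; exact: measurable_funD.
Qed.

Lemma cmeasurableM f g : cmeasurable f -> cmeasurable g ->
  cmeasurable (fun u => f u * g u).
Proof.
move=> [fr fi] [gr gi]; split.
- by under eq_fun do rewrite ReM; apply: measurable_funB; exact: measurable_funM.
- by under eq_fun do rewrite ImM; apply: measurable_funD; exact: measurable_funM.
Qed.

Lemma cmeasurableN f : cmeasurable f -> cmeasurable (fun u => - f u).
Proof.
move=> mf; have := cmeasurableM (cmeasurable_cst (-1)) mf.
by under eq_fun do rewrite mulN1r.
Qed.

Lemma cmeasurable_conj f : cmeasurable f -> cmeasurable (fun u => (f u)^*).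
Proof.
move=> [fr fi]; split.
- by rewrite [X in measurable_fun _ X](_ : _ = fun u => Re (f u))//;
    apply/funext => u; case: (f u).
- rewrite [X in measurable_fun _ X](_ : _ = fun u => - Im (f u)).
    exact: measurableT_comp.
  by apply/funext => u; case: (f u).
Qed.

Lemma cmeasurable_sum (I : Type) (s : seq I) (P : pred I) (F : I -> T -> C) :
  (forall i, cmeasurable (F i)) -> cmeasurable (fun u => \sum_(i <- s | P i) F i u).
Proof.
move=> mF; elim: s => [|i s IHs].
  by under eq_fun do rewrite big_nil; exact: cmeasurable_cst.
under eq_fun do rewrite big_cons; case: (P i) => //; exact: cmeasurableD.
Qed.

Lemma cmeasurable_prod (I : Type) (s : seq I) (P : pred I) (F : I -> T -> C) :
  (forall i, cmeasurable (F i)) -> cmeasurable (fun u => \prod_(i <- s | P i) F i u).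
Proof.
move=> mF; elim: s => [|i s IHs].
  by under eq_fun do rewrite big_nil; exact: cmeasurable_cst.
under eq_fun do rewrite big_cons; case: (P i) => //; exact: cmeasurableM.
Qed.

Lemma cmeasurableX f n : cmeasurable f -> cmeasurable (fun u => f u ^+ n).
Proof.
move=> mf; elim: n => [|n IHn]; first exact: cmeasurable_cst.
by under eq_fun do rewrite exprS; exact: cmeasurableM.
Qed.

Lemma cmeasurable_cexp f : cmeasurable f -> cmeasurable (fun u => cexp (f u)).
Proof.
move=> [fr fi]; split.
- under eq_fun do rewrite Re_cexp; apply: measurable_funM.
    exact: measurableT_comp.
  by apply: measurableT_comp fi; apply: continuous_measurable_fun; exact: continuous_cos.
- under eq_fun do rewrite Im_cexp; apply: measurable_funM.
    exact: measurableT_comp.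
  by apply: measurableT_comp fi; apply: continuous_measurable_fun; exact: continuous_sin.
Qed.

(** Each component of the sum is a pointwise limit of measurable real partial sums. *)
Lemma cmeasurable_series (F : nat -> T -> C) :
  (forall n, cmeasurable (F n)) ->
  (forall u, series (fun n => Re (F n u)) @ \oo -->
      Re (limn (series (fun n => F n u : C^o))) /\
    series (fun n => Im (F n u)) @ \oo -->
      Im (limn (series (fun n => F n u : C^o)))) ->
  cmeasurable (fun u => limn (series (fun n => F n u : C^o))).
Proof.
move=> mF cF; split.
- apply: (@measurable_fun_cvg _ _ _ _ (fun n u => series (fun k => Re (F k u)) n)).
    move=> n; rewrite /series/=; apply: measurable_sum => k; exact: (mF k).1.
  by move=> u _; exact: (cF u).1.
- apply: (@measurable_fun_cvg _ _ _ _ (fun n u => series (fun k => Im (F k u)) n)).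
    move=> n; rewrite /series/=; apply: measurable_sum => k; exact: (mF k).2.
  by move=> u _; exact: (cF u).2.
Qed.

Lemma cmeasurable_theta (al be : R) (tau : C) f : 0 < Im tau -> cmeasurable f ->
  cmeasurable (fun u => theta_char al be (f u) tau).
Proof.
move=> t0 mf; have q01 := theta_ratio_lt1 t0.
have mt (k : int) : cmeasurable (fun u => theta_term al be (f u) tau k).
  apply: cmeasurable_cexp; apply: cmeasurableD; first exact: cmeasurable_cst.
  apply: cmeasurableM; first exact: cmeasurable_cst.
  by apply: cmeasurableD => //; exact: cmeasurable_cst.
apply: (@cmeasurableD
  (fun u => limn (series (fun n : nat => theta_term al be (f u) tau (Posz n) : C^o)))
  (fun u => limn (series (fun n : nat => theta_term al be (f u) tau (Negz n) : C^o)))).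
- apply: (cmeasurable_series (F := fun n u => theta_term al be (f u) tau (Posz n))) => // u.
  by have [] := complex_seriesP q01 (theta_Posz_dominated al be t0 (lexx `|Im (f u)|)).
- apply: (cmeasurable_series (F := fun n u => theta_term al be (f u) tau (Negz n))) => // u.
  by have [] := complex_seriesP q01 (theta_Negz_dominated al be t0 (lexx `|Im (f u)|)).
Qed.

End ComplexMeasurable.

Section ComplexBounded.
Context (T : Type) (R : realType).
Local Notation C := R[i].
Local Notation Re := (@complex.Re R).
Local Notation Im := (@complex.Im R).
Local Open Scope complex_scope.
Variable D : set T.
Implicit Types f g : T -> C.

Definition cbounded f :=
  exists K, forall u, D u -> `|Re (f u)| <= K /\ `|Im (f u)| <= K.

Lemma cbounded_cst (c : C) : cbounded (fun=> c).
Proof. by exists (`|Re c| + `|Im c|) => u _; rewrite lerDl lerDr !normr_ge0. Qed.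

Lemma cboundedD f g :
  cbounded f -> cbounded g -> cbounded (fun u => f u + g u).
Proof.
move=> [K fK] [L gL]; exists (K + L) => u Du.
have [fr fi] := fK u Du; have [gr gi] := gL u Du.
by rewrite ReD ImD; split; apply: le_trans (ler_normD _ _) _; apply: lerD.
Qed.

Lemma cboundedM f g : cbounded f -> cbounded g -> cbounded (fun u => f u * g u).
Proof.
move=> [K fK] [L gL]; exists (K * L + K * L) => u Du.
have [fr fi] := fK u Du; have [gr gi] := gL u Du.
rewrite ReM ImM; split.
- by rewrite (le_trans (ler_normB _ _))// !normrM lerD// ler_pM.
- by rewrite (le_trans (ler_normD _ _))// !normrM lerD// ler_pM.
Qed.

Lemma cboundedN f :
  cbounded f -> cbounded (fun u => - f u).
Proof. by move=> [K fK]; exists K => u /fK; case: (f u) => x y /=; rewrite !normrN. Qed.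

Lemma cbounded_sum (I : Type) (s : seq I) (F : I -> T -> C) :
  (forall i, cbounded (F i)) -> cbounded (fun u => \sum_(i <- s) F i u).
Proof.
move=> bF; elim: s => [|i s IHs].
  by under eq_fun do rewrite big_nil; exact: cbounded_cst.
by under eq_fun do rewrite big_cons; exact: cboundedD.
Qed.

Lemma cbounded_conj f : cbounded f -> cbounded (fun u => (f u)^*).
Proof.
move=> [K fK]; exists K => u /fK; case: (f u) => x y /=.
by rewrite normrN.
Qed.

Lemma cbounded_prod (I : Type) (s : seq I) (P : pred I) (F : I -> T -> C) :
  (forall i, cbounded (F i)) -> cbounded (fun u => \prod_(i <- s | P i) F i u).
Proof.
move=> mF; elim: s => [|i s IHs].
  by under eq_fun do rewrite big_nil; exact: cbounded_cst.
under eq_fun do rewrite big_cons; case: (P i) => //; exact: cboundedM.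
Qed.

Lemma cboundedX f n : cbounded f -> cbounded (fun u => f u ^+ n).
Proof.
move=> mf; elim: n => [|n IHn]; first exact: cbounded_cst.
by under eq_fun do rewrite exprS; exact: cboundedM.
Qed.

End ComplexBounded.

(** * Complex integrals over the unit cube *)

Section CubeIntegral.
Variable R : realType.
Local Notation C := R[i].
Local Notation TR := (measurableTypeR R).
Local Notation mun := (tuple_measure (@lebesgue_measure R)).
Local Notation cube := (box [set x : TR | 0 <= x <= 1]).
Local Open Scope complex_scope.

Lemma cRintegral_cube_shift n (v : 'I_n -> R) (f : n.-tuple TR -> C) :
  (forall k, 0 <= v k <= 1) -> cmeasurable f -> tperiodic f ->
  cRintegral (mun n) cube (fun u => f (tshift v u)) = cRintegral (mun n) cube f.
Proof.
move=> v01 [mr mi] fper; rewrite /cRintegral; congr (_ +i* _).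
- apply: (@Rintegral_cube_shift R n v (fun u => complex.Re (f u))) => //.
  by move=> k u; rewrite fper.
- apply: (@Rintegral_cube_shift R n v (fun u => complex.Im (f u))) => //.
  by move=> k u; rewrite fper.
Qed.

(** A complex scalar mixes the two components, so additivity of the real integral is used;
    integrability comes from boundedness on a cube of finite measure. *)
Lemma cRintegralZ n (c : C) (f : n.-tuple TR -> C) :
  cmeasurable f -> cbounded cube f ->
  cRintegral (mun n) cube (fun u => c * f u) = c * cRintegral (mun n) cube f.
Proof.
move=> [mr mi] [K fK].
have mC := @measurable_box _ _ _ n (@measurable_unit_itv R).
have ir : (mun n).-integrable cube (EFin \o (fun u => complex.Re (f u))).
  by apply: (integrable_cube (K := K)) => // u /fK[].
have ii : (mun n).-integrable cube (EFin \o (fun u => complex.Im (f u))).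
  by apply: (integrable_cube (K := K)) => // u /fK[].
have irZ r : (mun n).-integrable cube (EFin \o (fun u => r * complex.Re (f u))).
  by apply: (integrableZl mC r ir).
have iiZ r : (mun n).-integrable cube (EFin \o (fun u => r * complex.Im (f u))).
  by apply: (integrableZl mC r ii).
apply: complex_eq; rewrite /cRintegral ?ReM ?ImM /=.
- under eq_Rintegral do rewrite ReM.
  by rewrite RintegralB// !RintegralZl.
- under eq_Rintegral do rewrite ImM.
  by rewrite RintegralD// !RintegralZl.
Qed.

End CubeIntegral.

(** * The integrand of the scalar product *)

Section ThetaPair.
Variable R : realType.
Local Notation C := R[i].
Local Notation Re := (@complex.Re R).
Local Notation Im := (@complex.Im R).
Local Open Scope complex_scope.

(* The Gaussian compensates the modulus of the automorphy factor, whose phase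
   cancels between the two theta functions. *)
Definition theta_pair (al1 al2 be : R) (tau z : C) : C :=
  theta_char al1 be z tau * ((theta_char al2 be z tau)^*)%C *
  (expR (- (2 * pi * Im z ^+ 2 / Im tau)))%:C.

Section Quasiperiods.
Variables (be : R) (tau : C).
Hypothesis tau_gt0 : 0 < Im tau.

Lemma theta_pairD1 (al1 al2 : R) (z : C) :
  theta_pair al1 al2 be tau (z + 1) =
  cexp (2 * pi%:C * 'i * (al1 - al2)%:C) * theta_pair al1 al2 be tau z.
Proof.
rewrite /theta_pair !theta_charD1// ImD addr0 conjcM cexp_conj.
have -> : cexp (2 * pi%:C * 'i * (al1 - al2)%:C) =
    cexp (2 * pi%:C * 'i * al1%:C) * cexp ((2 * pi%:C * 'i * al2%:C)^*)%C :> C.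
  rewrite -cexpD; congr cexp.
  by rewrite -(rmorph_nat (real_complex R) 2); apply: complex_eq; rewrite /=; ring.
by ring.
Qed.

Lemma theta_pairDn (al1 al2 : R) (z : C) (n : nat) :
  theta_pair al1 al2 be tau (z + n%:R) =
  cexp (2 * pi%:C * 'i * ((al1 - al2) * n%:R)%:C) * theta_pair al1 al2 be tau z.
Proof.
elim: n => [|n IHn]; first by rewrite addr0 mulr0 rmorph0 mulr0 cexp0 mul1r.
rewrite -[n.+1%:R]natr1 addrA theta_pairD1 IHn mulrA -cexpD; congr (cexp _ * _).
by rewrite -[n.+1%:R]natr1 (mulrDr (al1 - al2)) mulr1 rmorphD/=; ring.
Qed.

(** The automorphy factor of [theta_charDtau] does not depend on the characteristic, so the pair
    collects its squared modulus, which the Gaussian absorbs exactly. *)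
Lemma theta_pairDtau (al1 al2 s : R) (z : C) :
  theta_pair al1 al2 be tau (z + s%:C * tau) =
  theta_pair (al1 + s) (al2 + s) be tau z.
Proof.
rewrite /theta_pair !theta_charDtau// conjcM cexp_conj.
set e := - _ - _.
(* The squared modulus of the automorphy factor is the quotient of the Gaussians at [z] and at
   [z + s * tau]. *)
have eE : cexp e * cexp (e^*)%C *
    (expR (- (2 * pi * Im (z + s%:C * tau) ^+ 2 / Im tau)))%:C =
    (expR (- (2 * pi * Im z ^+ 2 / Im tau)))%:C.
  rewrite -!cexp_real -!cexpD; congr cexp.
  have t0 : Im tau != 0 by rewrite gt_eqF.
  rewrite /e -(rmorph_nat (real_complex R) 2).
  move: t0; clear; case: tau z => [t1 t] [x y] /= t0.
  by apply: complex_eq; rewrite !expr2 /=; field.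
by rewrite -eE; ring.
Qed.

Lemma theta_pair_shift (al1 al2 : R) (z : C) :
  theta_pair (al1 + 1) (al2 + 1) be tau z = theta_pair al1 al2 be tau z.
Proof. by rewrite /theta_pair !theta_char_shift. Qed.

(** A full period raises both characteristics by 1, which a reindexing of the theta series
    undoes. *)
Lemma theta_pairD_tau (al1 al2 : R) (z : C) :
  theta_pair al1 al2 be tau (z + tau) = theta_pair al1 al2 be tau z.
Proof.
have := theta_pairDtau al1 al2 1 z.
by rewrite rmorph1 mul1r theta_pair_shift.
Qed.

Lemma theta_pair_diagD1 (al : R) (z : C) :
  theta_pair al al be tau (z + 1) = theta_pair al al be tau z.
Proof. by rewrite theta_pairD1 subrr rmorph0 mulr0 cexp0 mul1r. Qed.

Lemma theta_pair_bounded (al1 al2 M : R) : exists K, forall z : C, `|Im z| <= M ->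
  `|Re (theta_pair al1 al2 be tau z)| <= K /\ `|Im (theta_pair al1 al2 be tau z)| <= K.
Proof.
pose D := [set z : C | `|Im z| <= M].
have thB al : cbounded D (fun z => theta_char al be z tau).
  by have [K KP] := theta_char_bounded al be tau_gt0 M; exists K => z /KP.
apply: (cboundedM (D := D) (cboundedM (thB al1) (cbounded_conj (thB al2)))).
exists 1 => z _ /=; rewrite normr0 ler01 ger0_norm ?expR_ge0// expR_le1 oppr_le0.
by split=> //; rewrite divr_ge0 ?(ltW tau_gt0)// mulr_ge0 ?sqr_ge0// mulr_ge0// pi_ge0.
Qed.

Lemma cmeasurable_theta_pair d (T : measurableType d) (al1 al2 : R) (f : T -> C) :
  cmeasurable f -> cmeasurable (fun u => theta_pair al1 al2 be tau (f u)).
Proof.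
move=> mf; apply: cmeasurableM.
  apply: cmeasurableM; first exact: cmeasurable_theta.
  by apply: cmeasurable_conj; exact: cmeasurable_theta.
apply: cmeasurable_real; apply: measurableT_comp => //.
apply: measurableT_comp => //; apply: measurable_funM; last exact: measurable_cst.
apply: measurable_funM; first exact: measurable_cst.
by apply: measurable_funX; exact: mf.2.
Qed.

End Quasiperiods.
End ThetaPair.

(** * Distribution of the Gaussian weight over the theta factors *)

Section Integrand.
Variable R : realType.
Local Notation C := R[i].
Local Notation Re := (@complex.Re R).
Local Notation Im := (@complex.Im R).
Local Open Scope complex_scope.
Variables (tau : C) (m n : nat) (a b : R) (xi : C).
Hypotheses (tau_gt0 : 0 < Im tau) (m_gt0 : (0 < m)%N).
Hypothesis xiE : xi = a%:C * tau + b%:C.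

(* [HR_center] is the argument of the theta function of the centre of mass, and
   [HR_wave] the weighted squared modulus of the Jastrow factor. *)
Definition HR_center (z : 'I_n -> C) : C := m%:R * (\sum_p z p) + xi.

Definition HR_wave (z : 'I_n -> C) : C :=
  (\prod_(p < n) \prod_(q < n | (p < q)%N)
    theta_pair 2^-1 2^-1 2^-1 tau (z p - z q)) ^+ m.

Definition HR_integrand (al1 al2 : R) (z : 'I_n -> C) : C :=
  theta_pair al1 al2 0 (m%:R * tau) (HR_center z) * HR_wave z.

Lemma Im_mtau : Im (m%:R * tau) = m%:R * Im tau.
Proof. by rewrite -(rmorph_nat (real_complex R)) ImM /= mul0r addr0. Qed.

Lemma mtau_gt0 : 0 < Im (m%:R * tau).
Proof. by rewrite Im_mtau mulr_gt0// ltr0n. Qed.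

(** Lagrange's identity. Doubling the left side gives the sum over all ordered pairs, whose diagonal
    vanishes and which expands without any constraint on the indices. *)
Lemma sum_sqr_diff (y : 'I_n -> R) :
  \sum_(p < n) \sum_(q < n | (p < q)%N) (y p - y q) ^+ 2 =
  n%:R * (\sum_p y p ^+ 2) - (\sum_p y p) ^+ 2.
Proof.
set S := LHS.
have S2 : S + S = \sum_(p < n) \sum_(q < n) (y p - y q) ^+ 2.
  transitivity (S + \sum_(p < n) \sum_(q < n | (q < p)%N) (y p - y q) ^+ 2).
    congr (_ + _); rewrite /S (exchange_big_dep predT)//=.
    by apply: eq_bigr => p _; apply: eq_bigr => q _; ring.
  rewrite /S -big_split/=; apply: eq_bigr => p _.
  rewrite [RHS](bigID (fun q : 'I_n => (p < q)%N))/=; congr (_ + _).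
  rewrite [RHS](bigD1 p)/= ?ltnn// subrr expr0n add0r.
  by apply: eq_bigl => q; rewrite -leqNgt ltn_neqAle andbC.
have E : \sum_(p < n) \sum_(q < n) (y p - y q) ^+ 2 =
    2 * (n%:R * (\sum_p y p ^+ 2) - (\sum_p y p) ^+ 2).
  transitivity (\sum_(p < n)
      (n%:R * y p ^+ 2 - 2 * y p * (\sum_q y q) + \sum_q y q ^+ 2)).
    apply: eq_bigr => p _.
    transitivity (\sum_(q < n) (y p ^+ 2 - 2 * y p * y q + y q ^+ 2)).
      by apply: eq_bigr => q _; ring.
    by rewrite big_split big_split/= sumr_const card_ord
      -(mulr_natl (y p ^+ 2) n) sumrN -mulr_sumr.
  rewrite big_split big_split/= sumr_const card_ord sumrN -mulr_suml -!mulr_sumr.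
  by rewrite -(mulr_natl (\sum_q _)); ring.
by apply: (mulfI (x := 2)) => //; rewrite -E -S2; ring.
Qed.

(** With [Y] the sum of the [y p] and [t = Im tau], the centre has imaginary part
    [m * t * Y + a * t]. Its Gaussian supplies the linear term of the weight together with an extra
    [exp(- 2 pi a^2 t / m)], which the constant in front compensates; the Jastrow Gaussians supply
    the rest of the quadratic term by [sum_sqr_diff]. *)
Lemma HR_integrandE (i j : 'I_m) (z : 'I_n -> C) (x y : 'I_n -> R) :
  (forall p, z p = (x p)%:C + tau * (y p)%:C) ->
  HR_Phi tau xi i z * (HR_Phi tau xi j z)^* *
  (\prod_(p < n) expR (- (2 * pi * m%:R * n%:R * Im tau * y p ^+ 2)
                       - 4 * pi * a * Im tau * y p))%:C =
  (expR (2 * pi * a ^+ 2 * Im tau / m%:R))%:C *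
    HR_integrand (i%:R / m%:R) (j%:R / m%:R) z.
Proof.
move=> zE.
have t0 : Im tau != 0 by rewrite gt_eqF.
have m0 : m%:R != 0 :> R by rewrite pnatr_eq0 -lt0n.
have Imz p : Im (z p) = Im tau * y p by rewrite zE ImD ImM /= mulr0 !add0r.
have ImS : Im (\sum_p z p) = Im tau * \sum_p y p.
  by rewrite raddf_sum mulr_sumr; apply: eq_bigr => p _; exact: Imz.
have Imc : Im (HR_center z) = m%:R * (Im tau * \sum_p y p) + a * Im tau.
  rewrite /HR_center ImD xiE ImD ImM -(rmorph_nat (real_complex R)) ImM ImS/=; ring.
rewrite /HR_integrand /HR_wave /HR_Phi.
set P := \prod_(p < n) \prod_(q < n | (p < q)%N) vartheta tau (z p - z q).
pose e p q := expR (- (2 * pi * Im (z p - z q) ^+ 2 / Im tau)).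
have -> : \prod_(p < n) \prod_(q < n | (p < q)%N)
      theta_pair 2^-1 2^-1 2^-1 tau (z p - z q) =
    P * (P^*)%C * (\prod_(p < n) \prod_(q < n | (p < q)%N) e p q)%:C.
  rewrite /P !rmorph_prod/= -!big_split/=; apply: eq_bigr => p _.
  by rewrite !rmorph_prod/= -!big_split/=.
rewrite [theta_pair _ _ _ _ _]/theta_pair -/(HR_center z) Imc Im_mtau.
set th1 := theta_char _ _ _ _; set th2 := theta_char _ _ _ _.
rewrite !exprMn -rmorphXn/=.
rewrite !conjCE.
set E1 := (\prod_(p < n) expR _)%:C.
have EE : E1 = (expR (2 * pi * a ^+ 2 * Im tau / m%:R))%:C *
   (expR (- (2 * pi * (m%:R * (Im tau * \sum_p y p) + a * Im tau) ^+ 2 /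
              (m%:R * Im tau))))%:C *
   ((\prod_(p < n) \prod_(q < n | (p < q)%N) e p q) ^+ m)%:C.
  rewrite -!rmorphM/=; congr (_%:C).
  rewrite -expR_sum.
  have -> : \prod_(p < n) \prod_(q < n | (p < q)%N) e p q =
     expR (- (2 * pi * Im tau) * \sum_(p < n) \sum_(q < n | (p < q)%N) (y p - y q) ^+ 2).
    rewrite mulr_sumr expR_sum; apply: eq_bigr => p _.
    rewrite mulr_sumr expR_sum; apply: eq_bigr => q _.
    by rewrite /e ImB !Imz; congr expR; field.
  rewrite -expRM_natl -!expRD; congr expR.
  rewrite sum_sqr_diff.
  transitivity (- (2 * pi * m%:R * n%:R * Im tau) * (\sum_p y p ^+ 2)
                - 4 * pi * a * Im tau * \sum_p y p).
    by rewrite !mulr_sumr -sumrB; apply: eq_bigr => p _; ring.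
  by field; rewrite t0 m0.
rewrite EE !rmorphM !rmorphXn/=; ring.
Qed.

End Integrand.

(** * Translations of the integrand and their effect on the scalar products *)

Section Symmetries.
Variable R : realType.
Local Notation C := R[i].
Local Notation Re := (@complex.Re R).
Local Notation Im := (@complex.Im R).
Local Notation TR := (measurableTypeR R).
Local Open Scope complex_scope.

Lemma cbounded_theta_pair (T : Type) (D : set T) (al1 al2 be : R) (tau : C) (f : T -> C) :
  0 < Im tau -> cbounded D f -> cbounded D (fun u => theta_pair al1 al2 be tau (f u)).
Proof.
move=> t0 [M fM]; have [K KP] := theta_pair_bounded be t0 al1 al2 M.
by exists K => u /fM[_ /KP].
Qed.

(** The real part is [1 - 2 sin(pi x)^2]; the value 1 would force [sin(pi x) = 0], impossible
    strictly between consecutive zeros. *)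
Lemma cexp_2pi_neq1 (x : R) : 0 < `|x| < 1 -> cexp (2 * pi%:C * 'i * x%:C) != 1 :> C.
Proof.
move=> /andP[x0 x1]; apply/eqP => /(congr1 Re).
have -> : 2 * pi%:C * 'i * x%:C = 0 +i* ((pi * x) *+ 2) :> C.
  by rewrite -(rmorph_nat (real_complex R) 2); apply: complex_eq; rewrite /=; ring.
rewrite Re_cexp /= expR0 mul1r cos_mulr2n => E.
have s0 : sin (pi * x) ^+ 2 = 0 by have := cos2Dsin2 (pi * x); lra.
have : 0 < sin (pi * `|x|).
  by apply: sin_gt0_pi; rewrite mulr_gt0 ?pi_gt0//= -[ltRHS]mulr1 ltr_pM2l ?pi_gt0.
move: s0 => /eqP; rewrite sqrf_eq0 => /eqP s0.
by case: (ger0P x) => _; rewrite ?mulrN ?sinN s0 ?oppr0 ltxx.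
Qed.

Variables (tau : C) (m n : nat) (xi : C).
Hypotheses (tau_gt0 : 0 < Im tau) (m_gt0 : (0 < m)%N) (n_gt0 : (0 < n)%N).
Implicit Types (z : 'I_n -> C).
Local Notation center := (HR_center m xi).
Local Notation wave := (HR_wave tau m).
Local Notation integrand := (HR_integrand tau m xi).
Let mtau0 : 0 < Im (m%:R * tau) := mtau_gt0 tau_gt0 m_gt0.

Lemma HR_center_delta z k e :
  center (fun p => z p + (p == k)%:R * e) = center z + m%:R * e.
Proof.
have sE : \sum_(p < n) (p == k)%:R * e = e.
  rewrite (bigD1 k)//= eqxx mul1r big1 ?addr0// => p /negbTE ->.
  by rewrite mul0r.
by rewrite /HR_center big_split/= sE; ring.
Qed.

Lemma HR_center_translate z e :
  center (fun p => z p + e) = center z + m%:R * n%:R * e.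
Proof.
by rewrite /HR_center big_split/= sumr_const card_ord -(mulr_natl e n); ring.
Qed.

(** Moving one point by [e] changes each difference [z p - z q] by [e], by [- e] or not at all, so a
    period of the pair function is enough. *)
Lemma HR_wave_delta z k e :
  (forall w, theta_pair 2^-1 2^-1 2^-1 tau (w + e) = theta_pair 2^-1 2^-1 2^-1 tau w) ->
  wave (fun p => z p + (p == k)%:R * e) = wave z.
Proof.
move=> He; rewrite /HR_wave; congr (_ ^+ m).
apply: eq_bigr => p _; apply: eq_bigr => q _.
case: (p == k); case: (q == k); rewrite ?mul1r ?mul0r ?addr0//.
- by congr theta_pair; ring.
- by rewrite -[RHS]He; congr theta_pair; ring.
- by rewrite -[LHS]He; congr theta_pair; ring.
Qed.

Lemma HR_wave_translate z e : wave (fun p => z p + e) = wave z.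
Proof.
rewrite /HR_wave; congr (_ ^+ m).
by apply: eq_bigr => p _; apply: eq_bigr => q _; congr theta_pair; ring.
Qed.

(** The centre moves by [m], producing the phase [exp(2 pi i m (al1 - al2))]; it is 1 because both
    characteristics are multiples of [1/m]. *)
Lemma HR_integrand_delta1 (i j : nat) z k :
  integrand (i%:R / m%:R) (j%:R / m%:R) (fun p => z p + (p == k)%:R * 1) =
  integrand (i%:R / m%:R) (j%:R / m%:R) z.
Proof.
rewrite /HR_integrand HR_center_delta HR_wave_delta; last first.
  by move=> w; rewrite theta_pair_diagD1.
congr (_ * _); rewrite mulr1 theta_pairDn//.
have -> : ((i%:R / m%:R - j%:R / m%:R) * m%:R)%:C = (i%:Z - j%:Z)%:~R :> C.
  rewrite -mulrBl divfK ?pnatr_eq0 -?lt0n// rmorphB !rmorph_nat intrB.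
  by rewrite -!pmulrn.
by rewrite cexp_2pi_int mul1r.
Qed.

(** The centre moves by [m * tau], which is exactly one period of its theta function of modulus
    [m * tau]. *)
Lemma HR_integrand_delta_tau (al1 al2 : R) z k :
  integrand al1 al2 (fun p => z p + (p == k)%:R * tau) = integrand al1 al2 z.
Proof.
rewrite /HR_integrand HR_center_delta HR_wave_delta ?theta_pairD_tau//.
by move=> w; rewrite theta_pairD_tau.
Qed.

Let mn0 : m%:R * n%:R != 0 :> R.
Proof. by rewrite mulf_neq0 // pnatr_eq0 -lt0n. Qed.

Let mnE : m%:R * n%:R * ((m%:R * n%:R)^-1 : R)%:C = 1 :> C.
Proof.
have -> : m%:R * n%:R = (m%:R * n%:R : R)%:C :> C by rewrite rmorphM !rmorph_nat.
by rewrite -rmorphM/= divff.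
Qed.

(** A common translation leaves all differences fixed, and [1/(mn)] is the step that moves the
    centre by exactly 1. *)
Lemma HR_integrand_translate1 (al1 al2 : R) z :
  integrand al1 al2 (fun p => z p + ((m%:R * n%:R)^-1 : R)%:C) =
  cexp (2 * pi%:C * 'i * (al1 - al2)%:C) * integrand al1 al2 z.
Proof.
rewrite /HR_integrand HR_center_translate HR_wave_translate mnE.
by rewrite theta_pairD1// mulrA.
Qed.

(** The centre moves by [tau], which is [1/m] of the period [m * tau]; each characteristic therefore
    grows by [1/m]. *)
Lemma HR_integrand_translate_tau (al1 al2 : R) z :
  integrand al1 al2 (fun p => z p + tau * ((m%:R * n%:R)^-1 : R)%:C) =
  integrand (al1 + m%:R^-1) (al2 + m%:R^-1) z.
Proof.
rewrite /HR_integrand HR_center_translate HR_wave_translate.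
have -> : m%:R * n%:R * (tau * ((m%:R * n%:R)^-1 : R)%:C) =
    (m%:R^-1 : R)%:C * (m%:R * tau) :> C.
  have mV : (m%:R^-1 : R)%:C * m%:R = 1 :> C.
    have -> : m%:R = (m%:R : R)%:C :> C by rewrite rmorph_nat.
    by rewrite -rmorphM/= mulVf// pnatr_eq0 -lt0n.
  by rewrite mulrCA mnE mulrA mV mulr1 mul1r.
by rewrite theta_pairDtau.
Qed.

Definition HR_point (u : (n + n).-tuple TR) (p : 'I_n) : C :=
  (tnth u (lshift n p))%:C + tau * (tnth u (rshift n p))%:C.

Lemma HR_point_tshift v u :
  HR_point (tshift v u) =
  fun p => HR_point u p + ((v (lshift n p))%:C + tau * (v (rshift n p))%:C).
Proof. by apply/funext => p; rewrite /HR_point !tnth_mktuple !rmorphD/=; ring. Qed.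

Definition HR_fun (al1 al2 : R) (u : (n + n).-tuple TR) : C :=
  integrand al1 al2 (HR_point u).

Lemma HR_fun_periodic (i j : nat) : tperiodic (HR_fun (i%:R / m%:R) (j%:R / m%:R)).
Proof.
move=> k u; rewrite /HR_fun HR_point_tshift.
case: (splitP k) => l kl.
- have -> : k = lshift n l by exact: val_inj.
  rewrite -[RHS](HR_integrand_delta1 i j _ l); congr HR_integrand; apply/funext => p.
  by rewrite eq_lshift eq_rlshift mulr0 addr0 mulr1 rmorph_nat.
- have -> : k = rshift n l by exact: val_inj.
  rewrite -[RHS](HR_integrand_delta_tau _ _ _ l); congr HR_integrand; apply/funext => p.
  by rewrite eq_rshift eq_lrshift add0r rmorph_nat mulrC.
Qed.

Lemma cmeasurable_HR_point p : cmeasurable (fun u => HR_point u p).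
Proof.
apply: cmeasurableD; first by apply: cmeasurable_real; exact: measurable_tnth.
apply: cmeasurableM; first exact: cmeasurable_cst.
by apply: cmeasurable_real; exact: measurable_tnth.
Qed.

Lemma cmeasurable_HR_fun (al1 al2 : R) : cmeasurable (HR_fun al1 al2).
Proof.
have mp := cmeasurable_HR_point.
apply: cmeasurableM.
  apply: cmeasurable_theta_pair => //; apply: cmeasurableD; last exact: cmeasurable_cst.
  by apply: cmeasurableM; [exact: cmeasurable_cst|exact: cmeasurable_sum].
apply: cmeasurableX; apply: cmeasurable_prod => p; apply: cmeasurable_prod => q.
by apply: cmeasurable_theta_pair => //; apply: cmeasurableD => //; exact: cmeasurableN.
Qed.

Local Notation cube := (box [set x : TR | 0 <= x <= 1]).

Lemma cbounded_HR_point p : cbounded cube (fun u => HR_point u p).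
Proof.
have bt k : cbounded cube (fun u : (n + n).-tuple TR => (tnth u k : R)%:C).
  by exists 1 => u /(_ k) /= /andP[u0 u1]; rewrite normr0 ler01 ger0_norm.
by apply: cboundedD => //; apply: cboundedM => //; exact: cbounded_cst.
Qed.

Lemma cbounded_HR_fun (al1 al2 : R) : cbounded cube (HR_fun al1 al2).
Proof.
have bp := cbounded_HR_point.
apply: cboundedM.
  apply: cbounded_theta_pair => //; apply: cboundedD; last exact: cbounded_cst.
  by apply: cboundedM; [exact: cbounded_cst|exact: cbounded_sum].
apply: cboundedX; apply: cbounded_prod => p; apply: cbounded_prod => q.
apply: cbounded_theta_pair => //; apply: cboundedD => //.
exact: cboundedN.
Qed.

Definition HR_gram (al1 al2 : R) : C :=
  cRintegral (tuple_measure (@lebesgue_measure R) (n + n)) cube (HR_fun al1 al2).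

Let mn01 : 0 <= (m%:R * n%:R : R)^-1 <= 1.
Proof.
by rewrite -natrM invr_ge0 ler0n invf_le1 ?ltr0n ?ler1n muln_gt0 m_gt0 n_gt0.
Qed.

(** The translation by [1/(mn)] preserves the integral by periodicity while multiplying the
    integrand by a constant phase. *)
Lemma HR_gram_rotate (i j : nat) : HR_gram (i%:R / m%:R) (j%:R / m%:R) =
  cexp (2 * pi%:C * 'i * (i%:R / m%:R - j%:R / m%:R)%:C) *
  HR_gram (i%:R / m%:R) (j%:R / m%:R).
Proof.
(* Only the first [n] coordinates, the [x] part, are moved. *)
pose v (k : 'I_(n + n)) : R := if (k < n)%N then (m%:R * n%:R)^-1 else 0.
have v01 k : 0 <= v k <= 1 by rewrite /v; case: ifP; rewrite ?lexx ?ler01.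
rewrite -[RHS](cRintegralZ _ (cmeasurable_HR_fun _ _) (cbounded_HR_fun _ _)).
rewrite -[LHS](cRintegral_cube_shift v01 (cmeasurable_HR_fun _ _) (@HR_fun_periodic i j)).
congr cRintegral; apply/funext => u.
rewrite /HR_fun HR_point_tshift -HR_integrand_translate1.
congr HR_integrand; apply/funext => p.
by rewrite /v /= ltn_ord ltnNge leq_addr/= mulr0 addr0.
Qed.

(** Distinct indices below [m] satisfy [0 < |i - j| / m < 1], so the phase in [HR_gram_rotate]
    differs from 1 and the integral must vanish. *)
Lemma HR_gram_orthogonal (i j : 'I_m) : i != j ->
  HR_gram (i%:R / m%:R) (j%:R / m%:R) = 0.
Proof.
move=> ij; have := HR_gram_rotate i j.
set G := HR_gram _ _; set c := cexp _ => /eqP.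
rewrite -subr_eq0 -[X in X - _]mul1r -mulrBl mulf_eq0 subr_eq0 eq_sym => /orP[|/eqP//].
rewrite (negbTE (cexp_2pi_neq1 _))//.
have m0 : 0 < m%:R :> R by rewrite ltr0n.
rewrite -mulrBl normrM normfV (gtr0_norm m0) ltr_pdivrMr// mul1r divr_gt0//=; last first.
  by rewrite normr_gt0 subr_eq0 eqr_nat.
have [im jm] : i%:R < m%:R :> R /\ j%:R < m%:R :> R by rewrite !ltr_nat !ltn_ord.
have [i0 j0] : 0 <= i%:R :> R /\ 0 <= j%:R :> R by rewrite !ler0n.
by rewrite ltr_norml; apply/andP; split; lra.
Qed.

(** Translating the [y] part by [1/(mn)] raises both characteristics by [1/m], so induction on [i]
    links every norm to that of characteristic 0. *)
Lemma HR_gram_diag (i : nat) : HR_gram (i%:R / m%:R) (i%:R / m%:R) = HR_gram 0 0.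
Proof.
elim: i => [|i <-]; first by rewrite mul0r.
pose v (k : 'I_(n + n)) : R := if (k < n)%N then 0 else (m%:R * n%:R)^-1.
have v01 k : 0 <= v k <= 1 by rewrite /v; case: ifP; rewrite ?lexx ?ler01.
rewrite -[RHS](cRintegral_cube_shift v01 (cmeasurable_HR_fun _ _) (@HR_fun_periodic i i)).
congr cRintegral; apply/funext => u.
rewrite /HR_fun HR_point_tshift -[i.+1%:R]natr1 mulrDl mul1r -HR_integrand_translate_tau.
congr HR_integrand; apply/funext => p.
by rewrite /v /= ltn_ord ltnNge leq_addr/= add0r.
Qed.

End Symmetries.

(** * The Gram matrix of the Haldane--Rezayi basis *)

Local Open Scope complex_scope.
Theorem theorem3p5 (R : realType) (tau : R[i]) (m n : nat) (a b : R)
    (xi : R[i]) (tau_gt0 : 0 < complex.Im tau) (m_gt0 : (0 < m)%N)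
    (n_gt0 : (0 < n)%N) (xiE : xi = a%:C * tau + b%:C) :
  exists c : R[i],
    gram_mx (HR_dot m tau a) (fun j : 'I_m => HR_Phi (n := n) tau xi j) = c%:M.
Proof.
(* The scalar is the constant left by completing the square in [HR_integrandE], times the normalised
   norm at characteristic 0. *)
exists ((expR (2 * pi * a ^+ 2 * complex.Im tau / m%:R))%:C * HR_gram tau m n xi 0 0).
apply/matrixP => i j; rewrite !mxE.
transitivity ((expR (2 * pi * a ^+ 2 * complex.Im tau / m%:R))%:C *
    HR_gram tau m n xi (i%:R / m%:R) (j%:R / m%:R)).
  rewrite -[RHS]cRintegralZ; [|exact: cmeasurable_HR_fun|exact: cbounded_HR_fun].
  congr cRintegral; apply/funext => u /=.
  have zE p : HR_point tau u p =
    (tnth u (lshift n p))%:C + tau * (tnth u (rshift n p))%:C by [].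
  exact: (HR_integrandE tau_gt0 m_gt0 xiE i j zE).
have [<-|ij] := eqVneq i j; first by rewrite HR_gram_diag.
by rewrite HR_gram_orthogonal// mulr0.
Qed.
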